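(* Let $0\leq \beta <1$ and let $f(z)=z+\sum_{n=2}^{\infty} a_n z^n$ be in the class $\mathcal{K}_{\sigma}(\beta)$ of bi-convex functions of order $\beta$. Then $$\left| a_2 a_4-a_3^2\right| \leq \frac{(1-\beta)^2}{24}\left(\frac{5\beta^2+8\beta-32}{3\beta^2-3\beta-4}\right).$$
   Context: Let $\mathcal{U}=\{z\in\mathbb{C}:|z|<1\}$. Let $\mathcal{A}$ be the family of functions $f$ analytic in $\mathcal{U}$ of the form $f(z)=z+\sum_{n=2}^{\infty}a_n z^n$, and let $\mathcal{S}\subset\mathcal{A}$ be the subclass of functions univalent (injective) in $\mathcal{U}$. Every $f\in\mathcal{S}$ has an inverse $f^{-1}$ satisfying $f^{-1}(f(z))=z$ for $z\in\mathcal{U}$ and $f(f^{-1}(w))=w$ for $|w|<r_0(f)$, where $r_0(f)\geq 1/4$. A function $f\in\mathcal{A}$ is bi-univalent in $\mathcal{U}$ if both $f$ and $f^{-1}$ are univalent in $\mathcal{U}$ (that is, $f$ is univalent in $\mathcal{U}$ and $f^{-1}$, defined near $0$, has an analytic continuation to $\mathcal{U}$, still denoted $f^{-1}$, which is univalent in $\mathcal{U}$); $\sigma$ denotes the class of bi-univalent functions. For $0\leq\beta<1$, the class of convex functions of order $\beta$ is $\mathcal{K}(\beta)=\{f\in\mathcal{S}:\Re(1+zf''(z)/f'(z))>\beta \text{ for all } z\in\mathcal{U}\}$. A function $f\in\sigma$ belongs to $\mathcal{K}_{\sigma}(\beta)$ (bi-convex of order $\beta$) if both $f$ and its inverse $f^{-1}$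 are convex of order $\beta$ in $\mathcal{U}$. *)

(* Defs.v *)
From Stdlib Require Import Reals.
From Coquelicot Require Import Coquelicot.
Open Scope R_scope.

Definition unit_disk (z : C) : Prop := Cmod z < 1.

(* Functions are total on C; only their values on the open unit disk (an open
   set, so also their derivatives there) are ever constrained. *)
Definition analytic_in_disk (f : C -> C) : Prop :=
  forall z : C, unit_disk z -> ex_derive (K := C_AbsRing) (V := C_NormedModule) f z.

Definition univalent_in_disk (f : C -> C) : Prop :=
  forall z1 z2 : C, unit_disk z1 -> unit_disk z2 -> f z1 = f z2 -> z1 = z2.

(* f(z) = z + a_2 z^2 + a_3 z^3 + ... for |z| < 1. *)
Definition normalized_expansion (f : C -> C) (a : nat -> C) : Prop :=
  a 0%nat = RtoC 0 /\ a 1%nat = RtoC 1 /\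
  forall z : C, unit_disk z ->
    is_pseries (K := C_AbsRing) (V := C_NormedModule) a z (f z).

Definition class_A (f : C -> C) : Prop :=
  analytic_in_disk f /\ exists a : nat -> C, normalized_expansion f a.

Definition class_S (f : C -> C) : Prop :=
  class_A f /\ univalent_in_disk f.

(* g is the analytic continuation to the unit disk of the germ at 0 of the
   inverse of f.  For f in S this determines g on the whole disk. *)
Definition inverse_continuation (f g : C -> C) : Prop :=
  analytic_in_disk g /\
  exists r : R, 0 < r /\
    forall w : C, Cmod w < r -> unit_disk (g w) /\ f (g w) = w.

Definition bi_univalent (f : C -> C) : Prop :=
  class_S f /\
  exists g : C -> C, inverse_continuation f g /\ univalent_in_disk g.

Definition convex_of_order (beta : R) (f : C -> C) : Prop :=
  class_S f /\
  forall z : C, unit_disk z ->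
    beta < Re (1 + z * C_derive (C_derive f) z / C_derive f z)%C.

Definition bi_convex_of_order (beta : R) (f : C -> C) : Prop :=
  bi_univalent f /\ convex_of_order beta f /\
  exists g : C -> C, inverse_continuation f g /\ convex_of_order beta g.

(* Main.v *)
Require Import Defs.
From Stdlib Require Import Reals Lra Lia.
From Coquelicot Require Import Coquelicot.
Open Scope R_scope.

(** Put [B = 1 - beta] and [P = 1 + z f'' / (B f')], which has positive real part, with
    coefficients [c1, c2, c3].  Then
      [144 (a2 a4 - a3^2) = B^2 (6 c1 c3 - 4 c2^2 + B c1^2 c2 - B^2 c1^4)].
    For [r < 1] the numbers [mk = ck r^k / 2] are the moments of the probability measure
    [Re P(r e^(i t)) dt / 2 pi] on the circle.  Integrating [(u - m1)^2] and
    [u (u - m1)^2] against it bounds [|m2 - m1^2|] and [|m3 - 2 m1 m2 + m1^3|] by the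
    variance [1 - |m1|^2], and these bounds give [|a2 a4 - a3^2| <= (22 / 144) B^2 / r^4].
    For [r] close to 1 this is below [19 B^2 / 96], while the right-hand side of the
    theorem is at least [19 B^2 / 96]. *)

(** * Complex differentiability *)

(** The measure itself is never built. All that is used of it is that [u^k -> mk], [k <= 3], sends
    polynomials with nonnegative real part on the circle to numbers with nonnegative real part, and
    this follows from the mean value property of a single analytic function. [P] need not extend to
    the unit circle, which is why it is replaced by [P (r z)], analytic in a disk of radius
    [1 / r > 1]. The mean value property is proved by differentiating under the integral sign, which
    takes only two complex derivatives; termwise differentiation of power series supplies them, so
    Cauchy's theory does not enter. Since [P] has [f'] in its denominator, [f' <> 0] must be known
    first; it is derived from the convexity inequality, along radii. Crude estimates suffice because
    [22 / 144] is well below [19 / 96], and [19 / 96] is [1 / 24] times the value [19 / 4] of the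
    quotient in the theorem at [beta = 1]. *)

Notation is_Cderive := (is_derive (K := C_AbsRing) (V := C_NormedModule)).

Lemma is_Cderive_eps (f : C -> C) (z l : C) :
  is_Cderive f z l <->
  forall eps : R, 0 < eps -> exists d : R, 0 < d /\ forall w : C,
    Cmod (w - z)%C < d ->
    Cmod (f w - f z - (w - z) * l)%C <= eps * Cmod (w - z)%C.
Proof.
split.
- intros [_ H] eps he.
  destruct (H z (fun P HP => HP) (mkposreal eps he)) as [d Hd].
  exists d; split; [apply cond_pos|].
  intros w hw; exact (Hd w hw).
- intros H; split; [apply (is_linear_scal_l (K := C_AbsRing) (V := C_NormedModule))|].
  intros x hx eps.
  (* The domination clause of [filterdiff] ranges over every limit point [x] of the neighbourhood
     filter; uniqueness of limits makes [x] equal to [z]. *)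
  rewrite <- (is_filter_lim_locally_unique (K := C_AbsRing)
    (V := AbsRing_NormedModule C_AbsRing) z x hx).
  destruct (H eps (cond_pos eps)) as [d [hd Hd]].
  exists (mkposreal d hd); intros w hw; exact (Hd w hw).
Qed.

(* Coquelicot equips C with two normed-module structures, which are not
   unifiable; its product and chain rules are stated for the other one. *)
Lemma is_Cderive_ring (f : C -> C) (z l : C) :
  is_Cderive f z l <->
  is_derive (K := C_AbsRing) (V := AbsRing_NormedModule C_AbsRing) f z l.
Proof.
split; intros [_ H]; (split; [apply is_linear_scal_l|]);
  intros x hx eps; exact (H x hx eps).
Qed.

Lemma is_Cderive_const (c z : C) : is_Cderive (fun _ => c) z (RtoC 0).
Proof. exact (is_derive_const (K := C_AbsRing) (V := C_NormedModule) c z). Qed.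

Lemma is_Cderive_id (z : C) : is_Cderive (fun w => w) z (RtoC 1).
Proof.
apply is_Cderive_eps; intros eps he; exists 1; split; [lra|]; intros w _.
replace (w - z - (w - z) * 1)%C with (RtoC 0) by ring.
rewrite Cmod_0; pose proof (Cmod_ge_0 (w - z)); nra.
Qed.

Lemma is_Cderive_plus (f g : C -> C) (z df dg : C) :
  is_Cderive f z df -> is_Cderive g z dg ->
  is_Cderive (fun w => f w + g w)%C z (df + dg)%C.
Proof. exact (is_derive_plus f g z df dg). Qed.

Lemma is_Cderive_mult (f g : C -> C) (z df dg : C) :
  is_Cderive f z df -> is_Cderive g z dg ->
  is_Cderive (fun w => f w * g w)%C z (df * g z + f z * dg)%C.
Proof.
intros hf hg.
apply is_Cderive_ring in hf, hg; apply is_Cderive_ring.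
exact (is_derive_mult (K := C_AbsRing) f g z df dg hf hg Cmult_comm).
Qed.

Lemma is_Cderive_comp (f g : C -> C) (z df dg : C) :
  is_Cderive f (g z) df -> is_Cderive g z dg ->
  is_Cderive (fun w => f (g w)) z (dg * df)%C.
Proof.
intros hf hg.
apply is_Cderive_ring in hg.
exact (is_derive_comp (K := C_AbsRing) (V := C_NormedModule) f g z df dg hf hg).
Qed.

Lemma is_Cderive_ext_disk (rho : R) (f g : C -> C) (z l : C) :
  (forall w, Cmod w < rho -> f w = g w) -> Cmod z < rho ->
  is_Cderive f z l -> is_Cderive g z l.
Proof.
intros heq hz H; apply is_Cderive_eps; intros eps he.
destruct (proj1 (is_Cderive_eps _ _ _) H eps he) as [d [hd Hd]].
exists (Rmin d (rho - Cmod z)); split; [apply Rmin_case; lra|].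
intros w hw.
assert (hwr : Cmod w < rho).
{ replace w with (z + (w - z))%C by ring.
  pose proof (Cmod_triangle z (w - z)).
  pose proof (Rmin_r d (rho - Cmod z)); lra. }
rewrite <- !heq by assumption; apply Hd.
pose proof (Rmin_l d (rho - Cmod z)); lra.
Qed.

Lemma is_Cderive_continuous (f : C -> C) (z l : C) :
  is_Cderive f z l ->
  forall eps : R, 0 < eps -> exists d : R, 0 < d /\ forall w : C,
    Cmod (w - z)%C < d -> Cmod (f w - f z)%C < eps.
Proof.
intros H eps he.
destruct (proj1 (is_Cderive_eps _ _ _) H 1 Rlt_0_1) as [d [hd Hd]].
pose proof (Cmod_ge_0 l) as hl.
exists (Rmin d (eps / (2 + Cmod l))); split.
{ apply Rmin_case; [lra|]; apply Rdiv_lt_0_compat; lra. }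
intros w hw.
assert (h1 : Cmod (w - z) < d) by (pose proof (Rmin_l d (eps / (2 + Cmod l))); lra).
assert (h2 : Cmod (w - z) < eps / (2 + Cmod l)) by (pose proof (Rmin_r d (eps / (2 + Cmod l))); lra).
replace (f w - f z)%C with ((f w - f z - (w - z) * l) + (w - z) * l)%C by ring.
eapply Rle_lt_trans; [apply Cmod_triangle|].
rewrite Cmod_mult.
specialize (Hd w h1).
assert (h3 : Cmod (w - z) * (2 + Cmod l) < eps).
{ apply Rlt_div_r in h2; lra. }
pose proof (Cmod_ge_0 (w - z)); nra.
Qed.

Lemma is_Cderive_inv (f : C -> C) (z l : C) :
  f z <> RtoC 0 -> is_Cderive f z l ->
  is_Cderive (fun w => / f w)%C z (- l * (/ f z * / f z))%C.
Proof.
intros hz H; apply is_Cderive_eps; intros eps he.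
set (m := Cmod (f z)).
assert (hm : 0 < m) by (apply Cmod_gt_0; assumption).
pose proof (Cmod_ge_0 l) as hl.
(* The error is a fraction with denominator [f w * (f z * f z)]. The bound [m / 2] inside [e2] keeps
   this denominator above [m^3 / 2]; [e1] and the other half of [e2] each make one of the two terms
   of the numerator at most [eps * D * m^3 / 4]. *)
set (e1 := eps * m * m / 4).
assert (he1 : 0 < e1) by (unfold e1; apply Rdiv_lt_0_compat; [repeat apply Rmult_lt_0_compat|]; lra).
destruct (proj1 (is_Cderive_eps _ _ _) H e1 he1) as [d1 [hd1 Hd1]].
set (e2 := Rmin (m / 2) (eps * m * m * m / (4 * (1 + Cmod l)))).
assert (he2 : 0 < e2).
{ unfold e2; apply Rmin_case; [lra|].
  apply Rdiv_lt_0_compat; [repeat apply Rmult_lt_0_compat|]; lra. }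
destruct (is_Cderive_continuous f z l H e2 he2) as [d2 [hd2 Hd2]].
exists (Rmin d1 d2); split; [apply Rmin_case; lra|].
intros w hw.
specialize (Hd1 w (Rlt_le_trans _ _ _ hw (Rmin_l _ _))).
specialize (Hd2 w (Rlt_le_trans _ _ _ hw (Rmin_r _ _))).
assert (h1 : Cmod (f w - f z) < m / 2) by (eapply Rlt_le_trans; [exact Hd2|apply Rmin_l]).
assert (h2 : Cmod (f w - f z) < eps * m * m * m / (4 * (1 + Cmod l))) by (eapply Rlt_le_trans; [exact Hd2|apply Rmin_r]).
assert (hw2 : m / 2 < Cmod (f w)).
{ pose proof (Cmod_triangle (f w) (- (f w - f z))) as ht.
  replace (f w + - (f w - f z))%C with (f z) in ht by ring.
  rewrite Cmod_opp in ht; fold m in ht; lra. }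
assert (hfw : f w <> RtoC 0).
{ intro h0; rewrite h0, Cmod_0 in hw2; lra. }
replace (/ f w - / f z - (w - z) * (- l * (/ f z * / f z)))%C
  with ((- f z * (f w - f z - (w - z) * l) + (w - z) * l * (f w - f z))
        * / (f w * (f z * f z)))%C by (field; split; assumption).
rewrite Cmod_mult, Cmod_inv, !Cmod_mult; fold m.
2:{ repeat apply Cmult_neq_0; assumption. }
set (D := Cmod (w - z)) in *.
assert (hD : 0 <= D) by apply Cmod_ge_0.
assert (hnum : Cmod (- f z * (f w - f z - (w - z) * l) + (w - z) * l * (f w - f z)) <= eps * D * (m * m * m / 2)).
{ eapply Rle_trans; [apply Cmod_triangle|].
  rewrite !Cmod_mult, Cmod_opp; fold m D.
  assert (A : m * Cmod (f w - f z - (w - z) * l) <= eps * D * (m * m * m / 4)).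
  { eapply Rle_trans; [apply Rmult_le_compat_l; [lra|exact Hd1]|].
    unfold e1; apply Req_le; field. }
  assert (A2 : (1 + Cmod l) * Cmod (f w - f z) <= eps * (m * m * m / 4)).
  { apply Rlt_le in h2.
    eapply Rle_trans; [apply Rmult_le_compat_l; [lra|exact h2]|].
    apply Req_le; field; lra. }
  assert (A3 : Cmod l * Cmod (f w - f z) <= eps * (m * m * m / 4)).
  { pose proof (Cmod_ge_0 (f w - f z)); lra. }
  apply (Rmult_le_compat_l D) in A3; [|assumption]; lra. }
apply Rle_div_l.
{ repeat apply Rmult_lt_0_compat; lra. }
eapply Rle_trans; [exact hnum|].
apply Rle_trans with (eps * D * (m / 2 * (m * m))); [apply Req_le; field|].
apply Rmult_le_compat_l; [apply Rmult_le_pos; lra|].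
apply Rmult_le_compat_r; nra.
Qed.

(** A finite order of differentiability, stable under sums, products, inverses and dilations. Order
    2 is what the integral argument takes: the first derivative is then continuous. *)
Fixpoint Cdiff (rho : R) (n : nat) (f : C -> C) : Prop :=
  match n with
  | O => True
  | S k => exists f' : C -> C,
      (forall z, Cmod z < rho -> is_Cderive f z (f' z)) /\ Cdiff rho k f'
  end.

Lemma Cdiff_S (rho : R) (n : nat) (f : C -> C) : Cdiff rho (S n) f -> Cdiff rho n f.
Proof.
revert f; induction n as [|n IH]; intros f; [easy|].
intros [f' [h1 h2]]; exists f'; split; [assumption|]; apply IH, h2.
Qed.

Lemma Cdiff_const (rho : R) (n : nat) (c : C) : Cdiff rho n (fun _ => c).
Proof.
revert c; induction n as [|n IH]; intros c; [easy|].
exists (fun _ => RtoC 0); split; [intros; apply is_Cderive_const|apply IH].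
Qed.

Lemma Cdiff_id (rho : R) (n : nat) : Cdiff rho n (fun w => w).
Proof.
destruct n as [|n]; [easy|].
exists (fun _ => RtoC 1); split; [intros; apply is_Cderive_id|apply Cdiff_const].
Qed.

Lemma Cdiff_plus (rho : R) (n : nat) (f g : C -> C) :
  Cdiff rho n f -> Cdiff rho n g -> Cdiff rho n (fun w => f w + g w)%C.
Proof.
revert f g; induction n as [|n IH]; intros f g; [easy|].
intros [f' [h1 h2]] [g' [h3 h4]]; exists (fun w => f' w + g' w)%C; split; [|auto].
intros z hz; apply is_Cderive_plus; auto.
Qed.

Lemma Cdiff_mult (rho : R) (n : nat) (f g : C -> C) :
  Cdiff rho n f -> Cdiff rho n g -> Cdiff rho n (fun w => f w * g w)%C.
Proof.
revert f g; induction n as [|n IH]; intros f g hf hg; [easy|].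
pose proof (Cdiff_S _ _ _ hf); pose proof (Cdiff_S _ _ _ hg).
destruct hf as [f' [h1 h2]], hg as [g' [h3 h4]].
exists (fun w => f' w * g w + f w * g' w)%C; split.
- intros z hz; apply is_Cderive_mult; auto.
- apply Cdiff_plus; apply IH; assumption.
Qed.

Lemma Cdiff_inv (rho : R) (n : nat) (f : C -> C) :
  (forall z, Cmod z < rho -> f z <> RtoC 0) ->
  Cdiff rho n f -> Cdiff rho n (fun w => / f w)%C.
Proof.
intros h0; induction n as [|n IH]; intros hf; [easy|].
pose proof (IH (Cdiff_S _ _ _ hf)).
destruct hf as [f' [h1 h2]].
(* Writing the sign as a factor makes the derivative a plain product, so that [Cdiff_mult] and the
   induction hypothesis apply. *)
exists (fun w => - (1) * f' w * (/ f w * / f w))%C; split.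
- intros z hz.
  replace (- (1) * f' z * (/ f z * / f z))%C with (- f' z * (/ f z * / f z))%C by ring.
  apply is_Cderive_inv; auto.
- repeat apply Cdiff_mult; auto; apply Cdiff_const.
Qed.

Lemma Cdiff_dilate (rho r : R) (n : nat) (f : C -> C) :
  0 < r -> Cdiff rho n f -> Cdiff (rho / r) n (fun w => f (r * w)%C).
Proof.
intros hr; revert f; induction n as [|n IH]; intros f; [easy|].
intros [f' [h1 h2]]; exists (fun w => RtoC r * f' (r * w))%C; split.
- intros z hz; apply (is_Cderive_comp f (fun w => (r * w)%C)).
  + apply h1; rewrite Cmod_mult, Cmod_R, Rabs_pos_eq by lra.
    apply Rlt_div_r in hz; lra.
  + pose proof (is_Cderive_mult _ _ z _ _ (is_Cderive_const r z) (is_Cderive_id z)) as H.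
    cbv beta in H; rewrite Cmult_0_l, Cplus_0_l, Cmult_1_r in H; exact H.
- apply Cdiff_mult; [apply Cdiff_const|apply IH, h2].
Qed.

(** * Power series in the unit disk *)

Notation is_Cseries := (is_series (K := C_AbsRing) (V := C_NormedModule)).

Lemma is_Cseries_ext (a b : nat -> C) (l : C) :
  (forall n, a n = b n) -> is_Cseries a l -> is_Cseries b l.
Proof. exact (is_series_ext (K := C_AbsRing) (V := C_NormedModule) a b l). Qed.

Lemma is_Cseries_lin (a b : nat -> C) (c la lb : C) :
  is_Cseries a la -> is_Cseries b lb ->
  is_Cseries (fun n => a n + c * b n)%C (la + c * lb)%C.
Proof.
intros ha hb.
exact (is_series_plus (K := C_AbsRing) (V := C_NormedModule) _ _ _ _ ha
  (is_series_scal (K := C_AbsRing) (V := C_NormedModule) c _ _ hb)).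
Qed.

Lemma is_Cseries_tail (a : nat -> C) (l : C) :
  is_Cseries a l -> is_Cseries (fun n => a (S n)) (l - a 0%nat)%C.
Proof.
intros h; apply (is_series_incr_1 (K := C_AbsRing) (V := C_NormedModule) a).
change (is_Cseries a (l - a 0%nat + a 0%nat)%C).
replace (l - a 0%nat + a 0%nat)%C with l by ring; exact h.
Qed.

Lemma is_Cseries_head (a : nat -> C) (l : C) :
  is_Cseries (fun n => a (S n)) l -> is_Cseries a (a 0%nat + l)%C.
Proof.
intros h; apply (is_series_decr_1 (K := C_AbsRing) (V := C_NormedModule) a).
change (is_Cseries (fun n => a (S n)) (a 0%nat + l - a 0%nat)%C).
replace (a 0%nat + l - a 0%nat)%C with l by ring; exact h.
Qed.

Lemma Cmod_Cseries_le (a : nat -> C) (b : nat -> R) (l : C) :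
  (forall n, Cmod (a n) <= b n) -> is_Cseries a l -> ex_series b ->
  Cmod l <= Series b.
Proof.
intros hab ha [L hb].
rewrite (is_series_unique b L hb).
assert (h1 : is_lim_seq (fun n => Cmod (sum_n a n)) (Cmod l)).
{ exact (filterlim_comp nat C_NormedModule R _ _ _ _ _ ha
    (filterlim_norm (K := C_AbsRing) (V := C_NormedModule) l)). }
assert (h2 : is_lim_seq (sum_n b) L) by exact hb.
refine (is_lim_seq_le _ _ _ _ _ h1 h2).
intros n; eapply Rle_trans;
  [exact (norm_sum_n_m (K := C_AbsRing) (V := C_NormedModule) a 0 n)|].
apply sum_n_m_le; exact hab.
Qed.

Definition Cseries_sum (a : nat -> C) : C :=
  iota (T := C_CompleteNormedModule) (fun l : C => is_Cseries a l).

Lemma Cseries_sum_correct (a : nat -> C) (b : nat -> R) :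
  (forall n, Cmod (a n) <= b n) -> ex_series b -> is_Cseries a (Cseries_sum a).
Proof.
intros hab hb.
apply (iota_correct (V := C_CompleteNormedModule) (fun l : C => is_Cseries a l)).
destruct (ex_series_le (K := C_AbsRing) (V := C_CompleteNormedModule) a b hab hb)
  as [l hl].
exists l; split; [exact hl|].
intros l' hl'.
exact (filterlim_locally_unique (K := C_AbsRing) (V := C_NormedModule)
  (sum_n a) l l' hl hl').
Qed.

Lemma is_Cseries_bounded (a : nat -> C) (l : C) :
  is_Cseries a l -> exists N : nat, forall n, (N <= n)%nat -> Cmod (a n) <= 2.
Proof.
intros h.
destruct (proj1 (filterlim_locally_ball_norm (K := C_AbsRing) (U := C_NormedModule) (sum_n a) l) h (mkposreal 1 Rlt_0_1))
  as [N HN].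
exists (S N); intros n hn; destruct n as [|n]; [lia|].
assert (h1 : Cmod (sum_n a n - l)%C < 1) by (apply (HN n); lia).
assert (h2 : Cmod (sum_n a (S n) - l)%C < 1) by (apply (HN (S n)); lia).
rewrite sum_Sn in h2; change plus with Cplus in h2.
replace (a (S n)) with ((sum_n a n + a (S n) - l) + - (sum_n a n - l))%C by ring.
eapply Rle_trans; [apply Cmod_triangle|]; rewrite Cmod_opp; lra.
Qed.

Definition summable_in_disk (b : nat -> R) : Prop :=
  forall rho, 0 < rho < 1 -> ex_series (fun n => b n * rho ^ n).

(** For [rho < s < 1], Bernoulli's inequality ([poly]) applied to [1 + x = s / rho] gives
    [n rho^n <= s^n / x], so a slightly larger radius absorbs the factor [n]. *)
Lemma summable_in_disk_INR (b : nat -> R) :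
  (forall n, 0 <= b n) -> summable_in_disk b ->
  summable_in_disk (fun n => INR n * b n).
Proof.
intros hb h rho hrho.
set (s := (1 + rho) / 2).
assert (hs : rho < s < 1) by (unfold s; lra).
set (x := s / rho - 1).
assert (hx : 0 < x).
{ unfold x; assert (1 < s / rho) by (apply Rlt_div_r; lra); lra. }
apply (ex_series_le (K := R_AbsRing) (V := R_CompleteNormedModule) _
  (fun n => / x * (b n * s ^ n))).
2:{ apply (ex_series_scal (K := R_AbsRing) (V := R_NormedModule) (/ x)); apply h; lra. }
intros n; change norm with Rabs.
pose proof (pow_le rho n (Rlt_le _ _ (proj1 hrho))) as hp.
rewrite Rabs_pos_eq by (repeat apply Rmult_le_pos; auto using pos_INR).
pose proof (poly n x hx) as hpoly.
replace (1 + x) with (s * / rho) in hpoly by (unfold x; field; lra).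
rewrite Rpow_mult_distr, pow_inv in hpoly.
assert (hr : 0 < rho ^ n) by (apply pow_lt; lra).
assert (hk : INR n * rho ^ n <= / x * s ^ n).
{ apply Rmult_le_reg_l with x; [assumption|].
  replace (x * (/ x * s ^ n)) with (s ^ n) by (field; lra).
  apply Rmult_le_reg_r with (/ rho ^ n); [apply Rinv_0_lt_compat; assumption|].
  replace (x * (INR n * rho ^ n) * / rho ^ n) with (INR n * x) by (field; lra).
  lra. }
specialize (hb n); nra.
Qed.

Definition Cpsum (a : nat -> C) (f : C -> C) : Prop :=
  forall z : C, Cmod z < 1 -> is_Cseries (fun n => a n * z ^ n)%C (f z).

(** Abel's lemma: convergence at a real point [s] with [rho < s < 1] bounds the terms there by 2
    from some index on, and the series at [rho] is then dominated by a geometric one of ratio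
    [rho / s]. *)
Lemma Cpsum_summable (a : nat -> C) (f : C -> C) :
  Cpsum a f -> summable_in_disk (fun n => Cmod (a n)).
Proof.
intros h rho hrho.
set (s := (1 + rho) / 2).
assert (hs : rho < s < 1) by (unfold s; lra).
destruct (is_Cseries_bounded _ _ (h (RtoC s) ltac:(rewrite Cmod_R, Rabs_pos_eq; lra)))
  as [N HN].
apply (proj2 (ex_series_incr_n (K := R_AbsRing) (V := R_NormedModule) _ N)).
apply (ex_series_le (K := R_AbsRing) (V := R_CompleteNormedModule) _
  (fun n => 2 * (rho / s) ^ N * (rho / s) ^ n)).
2:{ apply (ex_series_scal (K := R_AbsRing) (V := R_NormedModule) (2 * (rho / s) ^ N)).
    apply ex_series_geom; rewrite Rabs_pos_eq.
    - apply Rlt_div_l; lra.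
    - apply Rlt_le, Rdiv_lt_0_compat; lra. }
intros n; change norm with Rabs.
specialize (HN (N + n)%nat (Nat.le_add_r _ _)).
rewrite Cmod_mult, Cmod_pow, Cmod_R, (Rabs_pos_eq s) in HN by lra.
rewrite Rmult_assoc, <- pow_add.
assert (hr : 0 < rho ^ (N + n)) by (apply pow_lt; lra).
assert (hS : 0 < s ^ (N + n)) by (apply pow_lt; lra).
rewrite Rabs_pos_eq by (apply Rmult_le_pos; [apply Cmod_ge_0|lra]).
unfold Rdiv; rewrite Rpow_mult_distr, pow_inv.
apply Rmult_le_reg_r with (s ^ (N + n)); [assumption|].
replace (2 * (rho ^ (N + n) * / s ^ (N + n)) * s ^ (N + n)) with (2 * rho ^ (N + n)) by (field; lra).
nra.
Qed.

(** Second-order Taylor estimate for [z^n], by the recursion [R (n+1) = w R n + n z^(n-1) (w - z)^2]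
    for the remainder. The factor [rho ^ 2] on the left avoids the exponent [n - 2]; at [n = 0] the
    value of [pred 0] is harmless, being multiplied by [INR 0]. *)
Lemma Cpow_remainder (z w : C) (rho : R) (n : nat) :
  Cmod z <= rho -> Cmod w <= rho ->
  rho ^ 2 * Cmod (w ^ n - z ^ n - INR n * z ^ pred n * (w - z))%C
  <= INR n * INR n * rho ^ n * Cmod (w - z)%C ^ 2.
Proof.
intros hz hw.
pose proof (Cmod_ge_0 z); pose proof (Cmod_ge_0 w).
induction n as [|n IH].
{ simpl; replace (1 - 1 - 0 * 1 * (w - z))%C with (RtoC 0) by ring.
  rewrite Cmod_0; lra. }
assert (hrec : (w ^ S n - z ^ S n - INR (S n) * z ^ pred (S n) * (w - z)
  = w * (w ^ n - z ^ n - INR n * z ^ pred n * (w - z))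
    + INR n * z ^ pred n * (w - z) ^ 2)%C).
{ rewrite S_INR, RtoC_plus; simpl pred.
  destruct n as [|n]; simpl pred; rewrite !Cpow_S; [simpl|]; ring. }
rewrite hrec.
assert (hsq : rho ^ 2 * Cmod (INR n * z ^ pred n * (w - z) ^ 2)%C
  <= INR n * rho ^ S n * Cmod (w - z) ^ 2).
{ rewrite !Cmod_mult, !Cmod_pow, Cmod_R, Rabs_pos_eq by apply pos_INR.
  destruct n as [|n]; [simpl; lra|]; simpl pred.
  pose proof (pow_incr (Cmod z) rho n ltac:(lra)).
  replace (rho ^ S (S n)) with (rho ^ 2 * rho ^ n) by (simpl; ring).
  assert (0 <= INR (S n) * Cmod (w - z) ^ 2 * rho ^ 2).
  { apply Rmult_le_pos; [apply Rmult_le_pos; [apply pos_INR|]|]; apply pow2_ge_0. }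
  nra. }
eapply Rle_trans;
  [apply Rmult_le_compat_l; [apply pow2_ge_0|apply Cmod_triangle]|].
rewrite Rmult_plus_distr_l, Cmod_mult.
set (D := Cmod (w ^ n - z ^ n - INR n * z ^ pred n * (w - z))%C) in *.
assert (0 <= D) by apply Cmod_ge_0.
assert (0 <= rho) by lra.
pose proof (pow_le rho n ltac:(lra)).
pose proof (pow2_ge_0 (Cmod (w - z))).
pose proof (pos_INR n).
apply Rle_trans with (rho * (INR n * INR n * rho ^ n * Cmod (w - z) ^ 2)
  + INR n * rho ^ S n * Cmod (w - z) ^ 2).
{ apply Rplus_le_compat; [|assumption].
  apply Rle_trans with (rho * (rho ^ 2 * D)); [|apply Rmult_le_compat_l; assumption].
  assert (0 <= rho ^ 2 * D) by (apply Rmult_le_pos; [apply pow2_ge_0|assumption]).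
  nra. }
rewrite S_INR.
replace (rho ^ S n) with (rho * rho ^ n) by (simpl; ring).
assert (0 <= rho * rho ^ n * Cmod (w - z) ^ 2) 
  by (apply Rmult_le_pos; [apply Rmult_le_pos|]; assumption).
nra.
Qed.

(** Termwise differentiation: [Cpow_remainder], multiplied by [|a n|] and summed, bounds the error
    of the linear approximation by [K |w - z|^2]. The [n^2] in that estimate is the reason for
    applying [summable_in_disk_INR] twice. *)
Lemma Cpsum_derive (a : nat -> C) (f : C -> C) :
  Cpsum a f -> exists f' : C -> C,
    Cpsum (fun n => INR (S n) * a (S n))%C f' /\
    forall z, Cmod z < 1 -> is_Cderive f z (f' z).
Proof.
intros h.
pose proof (Cpsum_summable a f h) as hs.
pose proof (summable_in_disk_INR _ (fun n => Cmod_ge_0 _) hs) as hs1.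
pose proof (summable_in_disk_INR _
  (fun n => Rmult_le_pos _ _ (pos_INR n) (Cmod_ge_0 _)) hs1) as hs2.
(* The derived series keeps its vanishing term at [n = 0], so that it can be combined index by index
   with the series of [f]; the shift to [a (S n)] is done afterwards. *)
set (d := fun (z : C) (n : nat) => (INR n * z ^ pred n * a n)%C).
set (f' := fun z => Cseries_sum (d z)).
assert (hf' : forall z, Cmod z < 1 -> is_Cseries (d z) (f' z)).
{ intros z hz; pose proof (Cmod_ge_0 z).
  set (rho := (1 + Cmod z) / 2).
  assert (hr : 0 < rho < 1) by (unfold rho; lra).
  assert (hzr : Cmod z <= rho) by (unfold rho; lra).
  apply Cseries_sum_correct with (fun n => / rho * (INR n * Cmod (a n) * rho ^ n)).
  - intros n; unfold d; rewrite !Cmod_mult, Cmod_pow, Cmod_R, Rabs_pos_eq by apply pos_INR.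
    destruct n as [|n]; [simpl; lra|]; simpl pred.
    replace (/ rho * (INR (S n) * Cmod (a (S n)) * rho ^ S n))
      with (INR (S n) * rho ^ n * Cmod (a (S n))) by (simpl; field; lra).
    apply Rmult_le_compat_r; [apply Cmod_ge_0|].
    apply Rmult_le_compat_l; [apply pos_INR|].
    apply pow_incr; lra.
  - apply (ex_series_scal (K := R_AbsRing) (V := R_NormedModule) (/ rho)).
    apply hs1, hr. }
exists f'; split.
{ intros z hz.
  pose proof (is_Cseries_tail _ _ (hf' z hz)) as ht.
  replace (f' z - d z 0%nat)%C with (f' z) in ht by (unfold d; simpl; ring).
  eapply is_Cseries_ext; [|exact ht].
  intros n; unfold d; simpl pred; ring. }
intros z hz; apply is_Cderive_eps; intros eps he.
pose proof (Cmod_ge_0 z).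
set (rho := (1 + Cmod z) / 2).
assert (hr : 0 < rho < 1) by (unfold rho; lra).
assert (hzr : Cmod z < rho) by (unfold rho; lra).
set (M := Series (fun n => INR n * (INR n * Cmod (a n)) * rho ^ n)).
assert (hM : 0 <= M).
{ unfold M; rewrite <- (Rmult_0_l (Series (fun _ => 0))), <- Series_scal_l.
  apply Series_le; [|apply hs2, hr].
  intros n; rewrite Rmult_0_l; split; [lra|].
  repeat apply Rmult_le_pos; auto using pos_INR, Cmod_ge_0; apply pow_le; lra. }
set (K := / rho ^ 2 * M).
assert (hK : 0 <= K).
{ apply Rmult_le_pos; [|assumption]; apply Rlt_le, Rinv_0_lt_compat, pow_lt; lra. }
exists (Rmin (rho - Cmod z) (eps / (1 + K))); split.
{ apply Rmin_case; [lra|]; apply Rdiv_lt_0_compat; lra. }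
intros w hw.
assert (h1 : Cmod (w - z) < rho - Cmod z) by (eapply Rlt_le_trans; [exact hw|apply Rmin_l]).
assert (h2 : Cmod (w - z) < eps / (1 + K)) by (eapply Rlt_le_trans; [exact hw|apply Rmin_r]).
assert (hwr : Cmod w < rho).
{ replace w with (z + (w - z))%C by ring.
  pose proof (Cmod_triangle z (w - z)); lra. }
assert (hb : Cmod (f w - f z - (w - z) * f' z)%C
  <= Series (fun n => / rho ^ 2 * Cmod (w - z) ^ 2 * (INR n * (INR n * Cmod (a n)) * rho ^ n))).
{ apply Cmod_Cseries_le with (fun n =>
    a n * w ^ n + - (1) * (a n * z ^ n) + - (w - z) * d z n)%C.
  - intros n.
    replace (a n * w ^ n + - (1) * (a n * z ^ n) + - (w - z) * d z n)%C
      with (a n * (w ^ n - z ^ n - INR n * z ^ pred n * (w - z)))%C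
      by (unfold d; ring).
    rewrite Cmod_mult.
    pose proof (Cpow_remainder z w rho n ltac:(lra) ltac:(lra)) as hp.
    apply Rmult_le_reg_l with (rho ^ 2); [apply pow_lt; lra|].
    replace (rho ^ 2 * (/ rho ^ 2 * Cmod (w - z) ^ 2 * (INR n * (INR n * Cmod (a n)) * rho ^ n)))
      with (Cmod (a n) * (INR n * INR n * rho ^ n * Cmod (w - z) ^ 2)) by (field; lra).
    pose proof (Cmod_ge_0 (a n)); nra.
  - replace (f w - f z - (w - z) * f' z)%C
      with (f w + - (1) * f z + - (w - z) * f' z)%C by ring.
    apply is_Cseries_lin; [apply is_Cseries_lin|]; [apply h|apply h|apply hf']; lra.
  - apply (ex_series_scal (K := R_AbsRing) (V := R_NormedModule)
      (/ rho ^ 2 * Cmod (w - z) ^ 2)).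
    apply hs2, hr. }
rewrite Series_scal_l in hb; fold M in hb.
replace (/ rho ^ 2 * Cmod (w - z) ^ 2 * M) with (K * Cmod (w - z) * Cmod (w - z)) in hb
  by (unfold K; field; lra).
eapply Rle_trans; [exact hb|].
apply Rlt_div_r in h2; [|lra].
pose proof (Cmod_ge_0 (w - z)); nra.
Qed.

Lemma Cpsum_Cdiff (n : nat) (a : nat -> C) (f : C -> C) :
  Cpsum a f -> Cdiff 1 n f.
Proof.
revert a f; induction n as [|n IH]; intros a f h; [easy|].
destruct (Cpsum_derive a f h) as [f' [h1 h2]].
exists f'; split; [exact h2|]; exact (IH _ _ h1).
Qed.

(** Here [g] is the sum of the shifted series rather than the quotient [(f z - a 0) / z], so it is a
    power series at 0 as well, and the splitting can be iterated. *)
Lemma Cpsum_split (a : nat -> C) (f : C -> C) :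
  Cpsum a f -> exists g : C -> C, Cpsum (fun n => a (S n)) g /\
    forall z, Cmod z < 1 -> f z = (a 0%nat + z * g z)%C.
Proof.
intros h.
set (g := fun z => Cseries_sum (fun n => a (S n) * z ^ n)%C).
pose proof (Cpsum_summable a f h) as hs.
assert (hg : Cpsum (fun n => a (S n)) g).
{ intros z hz; pose proof (Cmod_ge_0 z).
  set (rho := (1 + Cmod z) / 2).
  assert (hr : 0 < rho < 1) by (unfold rho; lra).
  apply Cseries_sum_correct with (fun n => / rho * (Cmod (a (S n)) * rho ^ S n)).
  - intros n; rewrite Cmod_mult, Cmod_pow.
    replace (/ rho * (Cmod (a (S n)) * rho ^ S n)) with (Cmod (a (S n)) * rho ^ n)
      by (simpl; field; lra).
    apply Rmult_le_compat_l; [apply Cmod_ge_0|].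
    apply pow_incr; unfold rho; lra.
  - apply (ex_series_scal (K := R_AbsRing) (V := R_NormedModule) (/ rho)).
    apply (ex_series_incr_1 (K := R_AbsRing) (V := R_NormedModule)
      (fun n => Cmod (a n) * rho ^ n)).
    apply hs, hr. }
exists g; split; [exact hg|].
intros z hz.
assert (h0 : is_Cseries (fun n => a n * z ^ n)%C (a 0%nat + z * g z)%C).
{ replace (a 0%nat + z * g z)%C with (a 0%nat * z ^ 0 + z * g z)%C by (simpl; ring).
  apply (is_Cseries_head (fun n => a n * z ^ n)%C).
  apply is_Cseries_ext with (fun n => z * (a (S n) * z ^ n))%C.
  - intros n; rewrite Cpow_S; ring.
  - exact (is_series_scal (K := C_AbsRing) (V := C_NormedModule) z _ _ (hg z hz)). }
exact (filterlim_locally_unique (K := C_AbsRing) (V := C_NormedModule)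
  _ _ _ (h z hz) h0).
Qed.

(** * The mean value property *)

Lemma is_derive_eps (f : R -> R) (t l : R) :
  is_derive f t l <->
  forall eps : R, 0 < eps -> exists d : R, 0 < d /\ forall s : R,
    Rabs (s - t) < d -> Rabs (f s - f t - (s - t) * l) <= eps * Rabs (s - t).
Proof.
split.
- intros [_ H] eps he.
  destruct (H t (fun P HP => HP) (mkposreal eps he)) as [d Hd].
  exists d; split; [apply cond_pos|].
  intros s hs; exact (Hd s hs).
- intros H; split; [apply (is_linear_scal_l (K := R_AbsRing) (V := R_NormedModule))|].
  intros x hx eps.
  rewrite <- (is_filter_lim_locally_unique (K := R_AbsRing)
    (V := AbsRing_NormedModule R_AbsRing) t x hx).
  destruct (H eps (cond_pos eps)) as [d [hd Hd]].
  exists (mkposreal d hd); intros s hs; exact (Hd s hs).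
Qed.

Lemma Cmod_le_Re_Im (z : C) : Cmod z <= Rabs (Re z) + Rabs (Im z).
Proof.
pose proof (Rabs_pos (Re z)); pose proof (Rabs_pos (Im z)).
apply Rsqr_incr_0_var; [|lra].
unfold Cmod; rewrite Rsqr_sqrt by (apply Rplus_le_le_0_compat; apply pow2_ge_0).
unfold Rsqr; rewrite <- (pow2_abs (fst z)), <- (pow2_abs (snd z)).
unfold Re, Im in *; nra.
Qed.

Lemma Re_le_Cmod (z : C) : Rabs (Re z) <= Cmod z.
Proof. eapply Rle_trans; [apply Rmax_l|apply Rmax_Cmod]. Qed.

Lemma Im_le_Cmod (z : C) : Rabs (Im z) <= Cmod z.
Proof. eapply Rle_trans; [apply Rmax_r|apply Rmax_Cmod]. Qed.

Lemma is_derive_Cderive_curve (f : C -> C) (g : R -> C) (t : R) (l v : C) :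
  is_Cderive f (g t) l ->
  is_derive (fun s => Re (g s)) t (Re v) ->
  is_derive (fun s => Im (g s)) t (Im v) ->
  is_derive (fun s => Re (f (g s))) t (Re (v * l)%C) /\
  is_derive (fun s => Im (f (g s))) t (Im (v * l)%C).
Proof.
intros hf hr hi.
assert (H : forall eps : R, 0 < eps -> exists d : R, 0 < d /\ forall s : R,
  Rabs (s - t) < d ->
  Cmod (f (g s) - f (g t) - RtoC (s - t) * (v * l))%C <= eps * Rabs (s - t)).
{ intros eps he.
  pose proof (Cmod_ge_0 l) as hl; pose proof (Cmod_ge_0 v) as hv.
  (* The bound 1 keeps the increment of the curve below [(2 + |v|) |s - t|]. The other half of [e1]
     makes [E * l] cost at most half of [eps], and [e2] does the same for the remainder of [f]. *)
  set (e1 := Rmin 1 (eps / (4 * (1 + Cmod l)))).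
  assert (he1 : 0 < e1) by (unfold e1; apply Rmin_case; [lra|]; apply Rdiv_lt_0_compat; lra).
  assert (he1' : e1 <= 1) by apply Rmin_l.
  assert (he1'' : e1 * (4 * (1 + Cmod l)) <= eps).
  { apply Rle_div_r; [lra|apply Rmin_r]. }
  set (e2 := eps / (2 * (2 + Cmod v))).
  assert (he2 : 0 < e2) by (unfold e2; apply Rdiv_lt_0_compat; lra).
  assert (he2' : e2 * (2 * (2 + Cmod v)) = eps) by (unfold e2; field; lra).
  destruct (proj1 (is_derive_eps _ _ _) hr e1 he1) as [d1 [hd1 Hd1]].
  destruct (proj1 (is_derive_eps _ _ _) hi e1 he1) as [d2 [hd2 Hd2]].
  destruct (proj1 (is_Cderive_eps _ _ _) hf e2 he2) as [d3 [hd3 Hd3]].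
  exists (Rmin (Rmin d1 d2) (d3 / (2 + Cmod v))); split.
  { repeat apply Rmin_case; try lra; apply Rdiv_lt_0_compat; lra. }
  intros s hs.
  assert (hs12 : Rabs (s - t) < Rmin d1 d2) by (eapply Rlt_le_trans; [exact hs|apply Rmin_l]).
  assert (hs3 : Rabs (s - t) < d3 / (2 + Cmod v)) by (eapply Rlt_le_trans; [exact hs|apply Rmin_r]).
  specialize (Hd1 s (Rlt_le_trans _ _ _ hs12 (Rmin_l _ _))).
  specialize (Hd2 s (Rlt_le_trans _ _ _ hs12 (Rmin_r _ _))).
  apply Rlt_div_r in hs3; [|lra].
  pose proof (Rabs_pos (s - t)).
  set (E := (g s - g t - RtoC (s - t) * v)%C).
  assert (hE : Cmod E <= 2 * e1 * Rabs (s - t)).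
  { eapply Rle_trans; [apply Cmod_le_Re_Im|].
    replace (Re E) with (Re (g s) - Re (g t) - (s - t) * Re v)
      by (unfold E, Re; simpl; ring).
    replace (Im E) with (Im (g s) - Im (g t) - (s - t) * Im v)
      by (unfold E, Im; simpl; ring).
    lra. }
  assert (hg : Cmod (g s - g t) <= (2 + Cmod v) * Rabs (s - t)).
  { replace (g s - g t)%C with (E + RtoC (s - t) * v)%C by (unfold E; ring).
    eapply Rle_trans; [apply Cmod_triangle|].
    rewrite Cmod_mult, Cmod_R; nra. }
  specialize (Hd3 (g s) ltac:(lra)).
  replace (f (g s) - f (g t) - RtoC (s - t) * (v * l))%C
    with ((f (g s) - f (g t) - (g s - g t) * l) + E * l)%C by (unfold E; ring).
  eapply Rle_trans; [apply Cmod_triangle|]; rewrite Cmod_mult.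
  assert (e2 * Cmod (g s - g t) <= e2 * ((2 + Cmod v) * Rabs (s - t)))
    by (apply Rmult_le_compat_l; lra).
  assert (Cmod E * Cmod l <= 2 * e1 * Rabs (s - t) * Cmod l)
    by (apply Rmult_le_compat_r; assumption).
  nra. }
split; apply is_derive_eps; intros eps he;
  destruct (H eps he) as [d [hd Hd]]; exists d; (split; [exact hd|]);
  intros s hs; (eapply Rle_trans; [|exact (Hd s hs)]).
- eapply Rle_trans; [|apply Re_le_Cmod]; apply Req_le; f_equal.
  unfold Re; simpl; ring.
- eapply Rle_trans; [|apply Im_le_Cmod]; apply Req_le; f_equal.
  unfold Im; simpl; ring.
Qed.

Definition expi (t : R) : C := (cos t, sin t).

Lemma Cmod_expi (t : R) : Cmod (expi t) = 1.
Proof.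
unfold Cmod, expi; simpl fst; simpl snd.
rewrite <- sqrt_1; f_equal; pose proof (sin2_cos2 t); unfold Rsqr in *; lra.
Qed.

Lemma Cmod_polar (s t : R) : Cmod (s * expi t)%C = Rabs s.
Proof. rewrite Cmod_mult, Cmod_R, Cmod_expi; ring. Qed.

Lemma is_derive_radial (f : C -> C) (s t : R) (l : C) :
  is_Cderive f (s * expi t)%C l ->
  is_derive (fun r : R => Re (f (r * expi t)%C)) s (Re (expi t * l)%C).
Proof.
intros hf.
apply (is_derive_Cderive_curve f (fun r => (r * expi t)%C) s l (expi t) hf).
- apply (is_derive_ext (fun r => r * cos t)).
  { intros r; unfold Re, expi; simpl; ring. }
  unfold Re, expi; simpl; auto_derive; [trivial|ring].
- apply (is_derive_ext (fun r => r * sin t)).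
  { intros r; unfold Im, expi; simpl; ring. }
  unfold Im, expi; simpl; auto_derive; [trivial|ring].
Qed.

(* The Cauchy-Riemann equations: the angular derivative is [i s] times the radial one. *)
Lemma is_derive_angular (f : C -> C) (s t : R) (l : C) :
  is_Cderive f (s * expi t)%C l ->
  is_derive (fun r => Re (f (s * expi r)%C)) t (- s * Im (expi t * l)%C) /\
  is_derive (fun r => Im (f (s * expi r)%C)) t (s * Re (expi t * l)%C).
Proof.
intros hf.
destruct (is_derive_Cderive_curve f (fun r => (s * expi r)%C) t l (s * ((- sin t)%R, cos t))%C hf)
  as [h1 h2].
- apply (is_derive_ext (fun r => s * cos r)).
  { intros r; unfold Re, expi; simpl; ring. }
  unfold Re; simpl; auto_derive; [trivial|ring].
- apply (is_derive_ext (fun r => s * sin r)).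
  { intros r; unfold Im, expi; simpl; ring. }
  unfold Im; simpl; auto_derive; [trivial|ring].
- split.
  + replace (- s * Im (expi t * l)) with (Re (s * ((- sin t)%R, cos t) * l))%C; [exact h1|].
    unfold Re, Im, expi; simpl; ring.
  + replace (s * Re (expi t * l)) with (Im (s * ((- sin t)%R, cos t) * l))%C; [exact h2|].
    unfold Re, Im, expi; simpl; ring.
Qed.

(** Differentiation under the integral sign asks for continuity jointly in the radius and the
    angle. *)
Lemma continuity_2d_polar (f : C -> C) (s t : R) :
  (forall eps : R, 0 < eps -> exists d : R, 0 < d /\ forall w : C,
    Cmod (w - s * expi t)%C < d -> Cmod (f w - f (s * expi t))%C < eps) ->
  continuity_2d_pt (fun u v => Re (f (u * expi v)%C)) s t /\
  continuity_2d_pt (fun u v => Im (f (u * expi v)%C)) s t.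
Proof.
intros hf.
enough (H : forall eps : posreal, locally_2d (fun u v =>
  Cmod (f (u * expi v) - f (s * expi t))%C < eps) s t).
{ split; intros eps; generalize (H eps);
    apply locally_2d_impl, locally_2d_forall; intros u v h;
    (eapply Rle_lt_trans; [|exact h]).
  - exact (Re_le_Cmod (f (u * expi v) - f (s * expi t))%C).
  - exact (Im_le_Cmod (f (u * expi v) - f (s * expi t))%C). }
intros eps.
destruct (hf eps (cond_pos eps)) as [d [hd Hd]].
assert (hx : continuity_2d_pt (fun u v => u * cos v) s t).
{ apply continuity_2d_pt_mult; [apply continuity_2d_pt_id1|].
  apply (continuity_1d_2d_pt_comp cos (fun _ v => v));
    [apply continuity_cos|apply continuity_2d_pt_id2]. }
assert (hy : continuity_2d_pt (fun u v => u * sin v) s t).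
{ apply continuity_2d_pt_mult; [apply continuity_2d_pt_id1|].
  apply (continuity_1d_2d_pt_comp sin (fun _ v => v));
    [apply continuity_sin|apply continuity_2d_pt_id2]. }
assert (hd2 : 0 < d / 2) by lra.
generalize (locally_2d_and _ _ _ _ (hx (mkposreal _ hd2)) (hy (mkposreal _ hd2))).
apply locally_2d_impl, locally_2d_forall; intros u v [h1 h2].
apply Hd; simpl in h1, h2.
eapply Rle_lt_trans; [apply Cmod_le_Re_Im|].
replace (Re (u * expi v - s * expi t)) with (u * cos v - s * cos t)
  by (unfold Re, expi; simpl; ring).
replace (Im (u * expi v - s * expi t)) with (u * sin v - s * sin t)
  by (unfold Im, expi; simpl; ring).
lra.
Qed.

Lemma locally_Rabs_lt (rho s : R) : Rabs s < rho -> locally s (fun u => Rabs u < rho).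
Proof.
intros hs.
exists (mkposreal (rho - Rabs s) (Rlt_Rminus _ _ hs)); intros u hu.
change (Rabs (u - s) < rho - Rabs s) in hu.
replace u with (s + (u - s)) by ring; pose proof (Rabs_triang s (u - s)); lra.
Qed.

(** The integral [I s] over the circle of radius [s] is constant in [s]: by the Cauchy-Riemann
    equations the radial derivative of [Re f] is [1 / s] times the angular derivative of [Im f],
    whose integral over a full period vanishes. *)
Lemma mean_value_property (rho : R) (f : C -> C) :
  1 < rho -> Cdiff rho 2 f ->
  RInt (fun t => Re (f (expi t))) 0 (2 * PI) = 2 * PI * Re (f (RtoC 0)).
Proof.
intros hrho [f' [hf [f'' [hf' _]]]].
set (I := fun s : R => RInt (fun t => Re (f (s * expi t)%C)) 0 (2 * PI)).
assert (hin : forall s t, Rabs s < rho -> Cmod (s * expi t)%C < rho)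
  by (intros; rewrite Cmod_polar; assumption).
assert (hex : forall s, Rabs s < rho -> ex_RInt (fun t => Re (f (s * expi t)%C)) 0 (2 * PI)).
{ intros s hs; apply (ex_RInt_continuous (V := R_CompleteNormedModule)); intros t _.
  apply (ex_derive_continuous (V := R_NormedModule)); eexists.
  exact (proj1 (is_derive_angular f s t _ (hf _ (hin s t hs)))). }
assert (hcont : forall s t, Rabs s < rho ->
  continuity_2d_pt (fun u v => Re (expi v * f' (u * expi v))%C) s t).
{ intros s t hs.
  destruct (continuity_2d_polar f' s t
    (is_Cderive_continuous _ _ _ (hf' _ (hin s t hs)))) as [h1 h2].
  apply (continuity_2d_pt_ext (fun u v =>
    cos v * Re (f' (u * expi v)%C) - sin v * Im (f' (u * expi v)%C))).
  { intros; unfold expi; simpl; unfold Re, Im; ring. }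
  apply continuity_2d_pt_minus; (apply continuity_2d_pt_mult; [|assumption]).
  - apply (continuity_1d_2d_pt_comp cos (fun _ v => v));
      [apply continuity_cos|apply continuity_2d_pt_id2].
  - apply (continuity_1d_2d_pt_comp sin (fun _ v => v));
      [apply continuity_sin|apply continuity_2d_pt_id2]. }
assert (hD : forall s, Rabs s < rho ->
  is_derive I s (RInt (fun t => Re (expi t * f' (s * expi t))%C) 0 (2 * PI))).
{ intros s hs; unfold I.
  assert (hDer : forall u v, Rabs u < rho ->
    Derive (fun r : R => Re (f (r * expi v)%C)) u = Re (expi v * f' (u * expi v))%C).
  { intros u v hu; apply is_derive_unique.
    exact (is_derive_radial f u v _ (hf _ (hin u v hu))). }
  rewrite (RInt_ext (fun t => Re (expi t * f' (s * expi t))%C)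
    (fun t => Derive (fun r : R => Re (f (r * expi t)%C)) s))
    by (intros t _; symmetry; apply hDer; exact hs).
  apply (is_derive_RInt_param (fun r t => Re (f (r * expi t)%C))).
  - generalize (locally_Rabs_lt rho s hs); apply filter_imp; intros u hu t _.
    eexists; exact (is_derive_radial f u t _ (hf _ (hin u t hu))).
  - intros t _.
    apply (continuity_2d_pt_ext_loc (fun u v => Re (expi v * f' (u * expi v))%C)).
    + destruct (locally_Rabs_lt rho s hs) as [d Hd].
      exists d; intros u v hu _; symmetry; apply hDer, Hd, hu.
    + apply hcont, hs.
  - generalize (locally_Rabs_lt rho s hs); apply filter_imp; exact hex. }
assert (hzero : forall s, 0 < s < rho ->
  RInt (fun t => Re (expi t * f' (s * expi t))%C) 0 (2 * PI) = 0).
{ intros s hs.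
  assert (hsr : Rabs s < rho) by (rewrite Rabs_pos_eq; lra).
  apply is_RInt_unique.
  set (J := fun t => Im (f (s * expi t)%C) / s).
  replace 0 with (J (2 * PI) - J 0) at 2.
  2:{ unfold J, expi; rewrite cos_2PI, sin_2PI, cos_0, sin_0; ring. }
  apply (is_RInt_derive J).
  - intros t _; unfold J, Rdiv.
    replace (Re (expi t * f' (s * expi t)))%C
      with (/ s * (s * Re (expi t * f' (s * expi t))%C)) by (field; lra).
    apply (is_derive_ext (fun t => / s * Im (f (s * expi t)%C))); [intros; apply Rmult_comm|].
    apply is_derive_scal.
    exact (proj2 (is_derive_angular f s t _ (hf _ (hin s t hsr)))).
  - intros t _.
    destruct (is_derive_angular f' s t _ (hf' _ (hin s t hsr))) as [h1 h2].
    apply (continuous_ext (fun t => minus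
      (mult (cos t) (Re (f' (s * expi t)%C))) (mult (sin t) (Im (f' (s * expi t)%C))))).
    { intros; unfold minus, plus, opp, mult, expi; simpl; unfold Re, Im; ring. }
    apply (continuous_minus (V := R_NormedModule));
      apply (continuous_mult (K := R_AbsRing));
      apply (ex_derive_continuous (V := R_NormedModule));
      solve [eexists; eassumption | auto_derive; trivial]. }
(* [hzero] divides by [s] and excludes [s = 0]; the mean value theorem asks for the derivative only
   inside the interval, and for mere continuity at its ends. *)
assert (hI : I 1 - I 0 = 0 * (1 - 0)).
{ destruct (MVT_gen I 0 1 (fun _ => 0)) as [c [_ hc]]; [| |exact hc].
  - rewrite Rmin_left, Rmax_right by lra; intros s hs.
    rewrite <- (hzero s) by lra; apply hD; rewrite Rabs_pos_eq; lra.
  - rewrite Rmin_left, Rmax_right by lra; intros s hs.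
    apply continuity_pt_filterlim.
    apply (ex_derive_continuous (V := R_NormedModule) I); eexists; apply hD.
    rewrite Rabs_pos_eq; lra. }
assert (h1 : I 1 = RInt (fun t => Re (f (expi t))) 0 (2 * PI)).
{ unfold I; apply RInt_ext; intros t _; rewrite Cmult_1_l; reflexivity. }
assert (h0 : I 0 = 2 * PI * Re (f (RtoC 0))).
{ unfold I; rewrite (RInt_ext _ (fun _ => Re (f (RtoC 0)))).
  - rewrite RInt_const; unfold scal; simpl; unfold mult; simpl; ring.
  - intros t _; rewrite Cmult_0_l; reflexivity. }
lra.
Qed.

(** * Moments of functions with positive real part *)

Lemma minimum_principle (rho : R) (f : C -> C) :
  1 < rho -> Cdiff rho 2 f ->
  (forall z, Cmod z = 1 -> 0 <= Re (f z)) -> 0 <= Re (f (RtoC 0)).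
Proof.
intros hrho hf hpos.
pose proof (mean_value_property rho f hrho hf) as hm.
pose proof PI_RGT_0.
assert (hI : 0 <= RInt (fun t => Re (f (expi t))) 0 (2 * PI)).
{ apply RInt_ge_0; [lra| |intros t _; apply hpos, Cmod_expi].
  destruct hf as [f' [hf _]].
  apply (ex_RInt_continuous (V := R_CompleteNormedModule)); intros t _.
  apply (ex_derive_continuous (V := R_NormedModule)).
  assert (h1 : Cmod (1 * expi t)%C < rho) by (rewrite Cmod_polar, Rabs_R1; lra).
  eexists; apply (is_derive_ext (fun s => Re (f (1 * expi s)%C))).
  { intros s; rewrite Cmult_1_l; reflexivity. }
  exact (proj1 (is_derive_angular f 1 t _ (hf _ h1))). }
apply Rmult_le_reg_l with (2 * PI); lra.
Qed.

(* The functional sending [u^k] to [m_k] is positive on trigonometric polynomials. *)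
Definition positive_moments (m1 m2 m3 : C) : Prop :=
  forall a0 a1 a2 a3 : C,
    (forall u : C, Cmod u = 1 -> 0 <= Re (a0 + a1 * u + a2 * u ^ 2 + a3 * u ^ 3)%C) ->
    0 <= Re (a0 + a1 * m1 + a2 * m2 + a3 * m3)%C.

Lemma Cmod_sqr (z : C) : Cmod z ^ 2 = Re z ^ 2 + Im z ^ 2.
Proof.
unfold Cmod; rewrite pow2_sqrt; [reflexivity|].
apply Rplus_le_le_0_compat; apply pow2_ge_0.
Qed.

Lemma Cconj_unit (z : C) : Cmod z = 1 -> (z * Cconj z = 1)%C.
Proof. intros hz; rewrite <- Cmod2_conj, hz; f_equal; ring. Qed.

(* On [|z| = 1] the product of the real parts of [a0 + a1 conj z + ...] and [P] is half
   the real part of a function analytic in the disk: the negative powers of [z] it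
   contains are [conj z ^ k], and can be replaced by conjugates of powers of [z]. *)
Lemma Caratheodory_moments (rho : R) (P Q : C -> C) (c1 c2 c3 : C) :
  1 < rho -> Cdiff rho 2 P -> Cdiff rho 2 Q ->
  (forall z, Cmod z < rho ->
    P z = 1 + c1 * z + c2 * z ^ 2 + c3 * z ^ 3 + z ^ 4 * Q z)%C ->
  (forall z, Cmod z = 1 -> 0 <= Re (P z)) ->
  positive_moments (c1 / 2) (c2 / 2) (c3 / 2).
Proof.
intros hrho hP hQ hexp hpos a0 a1 a2 a3 hq.
(* The factors of [a1], [a2], [a3] are the expansion of [P] with its lowest terms removed and
   divided by [z], [z^2], [z^3]. The removed terms add up on the circle to [b] below; the last
   summand is [Cconj b], and [Cconj b - b] is purely imaginary. *)
set (F := fun z => ((Cconj a0 + Cconj a1 * z + Cconj a2 * (z * z) + Cconj a3 * (z * (z * z))) * P z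
  + a0 * P z
  + a1 * (c1 + c2 * z + c3 * (z * z) + z * (z * z) * Q z)
  + a2 * (c2 + c3 * z + z * z * Q z)
  + a3 * (c3 + z * Q z)
  + (Cconj (a1 + a2 * c1 + a3 * c2) * z + Cconj (a2 + a3 * c1) * (z * z)
     + Cconj a3 * (z * (z * z))))%C).
assert (hF : 0 <= Re (F (RtoC 0))).
{ apply (minimum_principle rho); [assumption| |].
  - unfold F.
    repeat first [apply Cdiff_plus | apply Cdiff_mult | assumption
      | apply Cdiff_const | apply Cdiff_id].
  - intros z hz.
    pose proof (Cconj_unit z hz) as hzz.
    set (zb := Cconj z) in *.
    set (q := (a0 + a1 * zb + a2 * zb ^ 2 + a3 * zb ^ 3)%C).
    set (b := ((a1 + a2 * c1 + a3 * c2) * zb + (a2 + a3 * c1) * zb ^ 2 + a3 * zb ^ 3)%C).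
    assert (hFz : F z = (Cconj q * P z + q * P z + (Cconj b - b))%C).
    { assert (hzb : Cconj zb = z) by apply Cconj_conj.
      unfold F, q, b.
      rewrite !Cplus_conj, !Cmult_conj, !Cpow_conj, !Cplus_conj, !Cmult_conj, hzb.
      rewrite (hexp z) by lra.
      ring [hzz]. }
    assert (hRe : Re (F z) = 2 * (Re q * Re (P z))).
    { rewrite hFz; unfold Re; simpl; ring. }
    rewrite hRe.
    assert (hzb : Cmod zb = 1) by (unfold zb; rewrite Cmod_conj; exact hz).
    pose proof (hq zb hzb); pose proof (hpos z hz); fold q in H.
    apply Rmult_le_pos; [lra|]; apply Rmult_le_pos; assumption. }
assert (hP0 : P (RtoC 0) = RtoC 1).
{ rewrite hexp by (rewrite Cmod_0; lra); ring. }
replace (F (RtoC 0)) with (Cconj a0 + (a0 + a1 * c1 + a2 * c2 + a3 * c3))%C in hF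
  by (unfold F; rewrite hP0; ring).
replace (Re (Cconj a0 + (a0 + a1 * c1 + a2 * c2 + a3 * c3))%C)
  with (2 * Re (a0 + a1 * (c1 / 2) + a2 * (c2 / 2) + a3 * (c3 / 2))%C) in hF; [lra|].
replace (c1 / 2)%C with (RtoC (/ 2) * c1)%C by (rewrite RtoC_inv by lra; field).
replace (c2 / 2)%C with (RtoC (/ 2) * c2)%C by (rewrite RtoC_inv by lra; field).
replace (c3 / 2)%C with (RtoC (/ 2) * c3)%C by (rewrite RtoC_inv by lra; field).
unfold Re; simpl; field.
Qed.

Lemma unimodular_phase (z : C) : exists e : C, Cmod e = 1 /\ (e * z = Cmod z)%C.
Proof.
destruct (Req_dec (Cmod z) 0) as [h|h].
- exists (RtoC 1); split; [apply Cmod_1|].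
  rewrite h, (Cmod_eq_0 z h); ring.
- assert (hz : RtoC (Cmod z) <> 0) by (intro e; apply h; injection e; auto).
  exists (Cconj z / Cmod z)%C; split.
  + rewrite Cmod_div, Cmod_conj, Cmod_R, Rabs_pos_eq by (try exact hz; apply Cmod_ge_0).
    field; exact h.
  + replace (Cconj z / Cmod z * z)%C with (z * Cconj z / Cmod z)%C by (field; exact hz).
    rewrite <- Cmod2_conj, RtoC_pow; field; exact hz.
Qed.

(* [|<p, 1>| <= <|u - m1|^2, 1> = 1 - |m1|^2] for a polynomial [p] dominated by [|u - m1|^2]. *)
Lemma moment_variance_bound (m1 m2 m3 b0 b1 b2 b3 : C) :
  positive_moments m1 m2 m3 ->
  (forall u : C, Cmod u = 1 ->
    Cmod (b0 + b1 * u + b2 * u ^ 2 + b3 * u ^ 3)%C <= Cmod (u - m1)%C ^ 2) ->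
  Cmod (b0 + b1 * m1 + b2 * m2 + b3 * m3)%C <= 1 - Cmod m1 ^ 2.
Proof.
intros hm hb.
destruct (unimodular_phase (b0 + b1 * m1 + b2 * m2 + b3 * m3)) as [e [he heX]].
(* On the circle [|u - m1|^2] is the real part of [1 + |m1|^2 - 2 Cconj m1 u], so the polynomial
   tested here has real part [|u - m1|^2 - Re (e p)]. The phase [e] turns the resulting bound on a
   real part into one on a modulus. *)
assert (H : 0 <= Re ((1 + Cmod m1 ^ 2)%R - e * b0 + (- 2%R * Cconj m1 - e * b1) * m1
  + (- e * b2) * m2 + (- e * b3) * m3)%C).
{ apply hm; intros u hu.
  set (p := (b0 + b1 * u + b2 * u ^ 2 + b3 * u ^ 3)%C).
  replace ((1 + Cmod m1 ^ 2)%R - e * b0 + (- 2%R * Cconj m1 - e * b1) * u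
    + (- e * b2) * u ^ 2 + (- e * b3) * u ^ 3)%C
    with ((1 + Cmod m1 ^ 2)%R - 2%R * (Cconj m1 * u) - e * p)%C by (unfold p; ring).
  assert (h1 : Re (e * p)%C <= Cmod p).
  { pose proof (Re_le_Cmod (e * p)) as h; rewrite Cmod_mult, he in h.
    pose proof (Rle_abs (Re (e * p)%C)); lra. }
  specialize (hb u hu); fold p in hb.
  assert (h2 : Cmod (u - m1)%C ^ 2 = 1 + Cmod m1 ^ 2 - 2 * Re (Cconj m1 * u)%C).
  { pose proof (Cmod_sqr u) as hs; rewrite hu in hs.
    rewrite !Cmod_sqr; unfold Re, Im in *; simpl in *; nra. }
  replace (Re ((1 + Cmod m1 ^ 2)%R - 2%R * (Cconj m1 * u) - e * p)%C)
    with (1 + Cmod m1 ^ 2 - 2 * Re (Cconj m1 * u)%C - Re (e * p)%C)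
    by (unfold Re; simpl; ring).
  lra. }
replace ((1 + Cmod m1 ^ 2)%R - e * b0 + (- 2%R * Cconj m1 - e * b1) * m1
  + (- e * b2) * m2 + (- e * b3) * m3)%C
  with ((1 + Cmod m1 ^ 2)%R - 2%R * (m1 * Cconj m1)
        - e * (b0 + b1 * m1 + b2 * m2 + b3 * m3))%C in H by ring.
rewrite heX, <- Cmod2_conj in H.
set (X := Cmod (b0 + b1 * m1 + b2 * m2 + b3 * m3)%C) in *.
unfold Re in H; simpl in H; simpl; lra.
Qed.

Lemma moment2_bound (m1 m2 m3 : C) :
  positive_moments m1 m2 m3 -> Cmod (m2 - m1 ^ 2)%C <= 1 - Cmod m1 ^ 2.
Proof.
intros hm; replace (m2 - m1 ^ 2)%C with (m1 ^ 2 + (- 2%R * m1) * m1 + 1 * m2 + 0 * m3)%C by (simpl; ring).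
apply moment_variance_bound; [exact hm|]; intros u hu.
replace (m1 ^ 2 + - 2%R * m1 * u + 1 * u ^ 2 + 0 * u ^ 3)%C with ((u - m1) ^ 2)%C by (simpl; ring).
rewrite Cmod_pow; lra.
Qed.

Lemma moment3_bound (m1 m2 m3 : C) :
  positive_moments m1 m2 m3 ->
  Cmod (m3 - 2%R * m1 * m2 + m1 ^ 3)%C <= 1 - Cmod m1 ^ 2.
Proof.
intros hm; replace (m3 - 2%R * m1 * m2 + m1 ^ 3)%C
  with (0 + m1 ^ 2 * m1 + (- 2%R * m1) * m2 + 1 * m3)%C by (simpl; ring).
apply moment_variance_bound; [exact hm|]; intros u hu.
replace (0 + m1 ^ 2 * u + - 2%R * m1 * u ^ 2 + 1 * u ^ 3)%C with (u * (u - m1) ^ 2)%C by (simpl; ring).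
rewrite Cmod_mult, Cmod_pow, hu; lra.
Qed.

Lemma moment3_le_1 (m1 m2 m3 : C) : positive_moments m1 m2 m3 -> Cmod m3 <= 1.
Proof.
intros hm.
destruct (unimodular_phase m3) as [e [he hem]].
assert (H : 0 <= Re (1 + 0 * m1 + 0 * m2 + - e * m3)%C).
{ apply hm; intros u hu.
  pose proof (Re_le_Cmod (e * u ^ 3)) as h.
  rewrite Cmod_mult, Cmod_pow, he, hu in h.
  pose proof (Rle_abs (Re (e * u ^ 3)%C)).
  replace (1 + 0 * u + 0 * u ^ 2 + - e * u ^ 3)%C with (1 - e * u ^ 3)%C by ring.
  change (0 <= 1 - Re (e * u ^ 3)%C); lra. }
replace (1 + 0 * m1 + 0 * m2 + - e * m3)%C with (1 - e * m3)%C in H by ring.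
rewrite hem in H; unfold Re in H; simpl in H; lra.
Qed.

(* With [M2 = m2 - m1^2] and [M3 = m3 - 2 m1 m2 + m1^3] one has
   [m1 m3 - m2^2 = m1 M3 - M2^2]. *)
Lemma moment_Hankel_bound (m1 m2 m3 : C) (B : R) :
  positive_moments m1 m2 m3 -> 0 <= B <= 1 ->
  Cmod (24%R * (m1 * m3) - 16%R * m2 ^ 2
        + 8%R * B * (m1 ^ 2 * m2) - 16%R * B ^ 2 * m1 ^ 4)%C <= 22.
Proof.
intros hm hB.
pose proof (moment2_bound _ _ _ hm) as h2; pose proof (moment3_bound _ _ _ hm) as h3.
pose proof (moment3_le_1 _ _ _ hm) as h31.
set (M2 := (m2 - m1 ^ 2)%C) in *; set (M3 := (m3 - 2%R * m1 * m2 + m1 ^ 3)%C) in *.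
set (x := Cmod m1) in *.
pose proof (Cmod_ge_0 m1 : 0 <= x) as hx0.
pose proof (Cmod_ge_0 M2) as h20; pose proof (Cmod_ge_0 M3).
pose proof (Cmod_ge_0 m3).
assert (hx1 : x <= 1) by nra.
(* The weight 24 is split as [16 + 8]: the part [16 (m1 m3 - m2^2)] goes through [M2] and [M3],
   while [8 m1 m3] is bounded by [|m3| <= 1]. The last bracket is [m2 - 2 B m1^2], of modulus at
   most [(1 - x^2) + x^2]. *)
replace (24%R * (m1 * m3) - 16%R * m2 ^ 2
        + 8%R * B * (m1 ^ 2 * m2) - 16%R * B ^ 2 * m1 ^ 4)%C
  with (16%R * (m1 * M3) + - 16%R * M2 ^ 2 + 8%R * (m1 * m3)
        + RtoC (8 * B) * (m1 ^ 2 * (M2 + RtoC (1 - 2 * B) * m1 ^ 2)))%C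
  by (unfold M2, M3; rewrite RtoC_minus, !RtoC_mult; simpl; ring).
assert (hK : Cmod (M2 + RtoC (1 - 2 * B) * m1 ^ 2)%C <= 1).
{ eapply Rle_trans; [apply Cmod_triangle|].
  rewrite Cmod_mult, Cmod_pow, Cmod_R; fold x.
  assert (Rabs (1 - 2 * B) <= 1) by (apply Rabs_le; lra).
  nra. }
pose proof (Cmod_ge_0 (M2 + RtoC (1 - 2 * B) * m1 ^ 2)).
eapply Rle_trans; [apply Cmod_triangle|].
eapply Rle_trans; [apply Rplus_le_compat_r, Cmod_triangle|].
eapply Rle_trans; [apply Rplus_le_compat_r, Rplus_le_compat_r, Cmod_triangle|].
rewrite !Cmod_mult, Cmod_opp, !Cmod_pow, !Cmod_R; fold x.
rewrite !Rabs_pos_eq by lra.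
set (s := 1 - x ^ 2) in *.
assert (t1 : x * Cmod M3 <= x * s) by (apply Rmult_le_compat_l; assumption).
assert (t2 : Cmod M2 ^ 2 <= s ^ 2) by (apply pow_incr; lra).
assert (t3 : x * Cmod m3 <= x) by nra.
assert (t4 : 8 * B * (x ^ 2 * Cmod (M2 + RtoC (1 - 2 * B) * m1 ^ 2)) <= 8 * x ^ 2).
{ pose proof (pow2_ge_0 x).
  assert (x ^ 2 * Cmod (M2 + RtoC (1 - 2 * B) * m1 ^ 2) <= x ^ 2) by nra.
  assert (0 <= x ^ 2 * Cmod (M2 + RtoC (1 - 2 * B) * m1 ^ 2)) by (apply Rmult_le_pos; assumption).
  nra. }
(* The left-hand side equals [16 + 24 x (1 - x) - 16 x^3 (1 - x)], and [x (1 - x) <= 1 / 4] gives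
   [16 + 6 = 22]. *)
assert (t5 : 16 * (x * s) + 16 * s ^ 2 + 8 * x + 8 * x ^ 2 <= 22).
{ unfold s.
  assert (0 <= x ^ 3 * (1 - x)) by (apply Rmult_le_pos; [apply pow_le|]; lra).
  pose proof (pow2_ge_0 (2 * x - 1)); nra. }
lra.
Qed.

(** * Convex functions of order [beta] *)

(* [t |-> t^2 |h (t z)|^2] is nondecreasing on [0, 1], since its derivative is
   [2 t |h|^2 Re (1 + t z h' / h)] where [h <> 0] and 0 elsewhere; hence a zero of [h]
   at [z] would propagate along the radius down to the origin. *)
Lemma convexity_nonvanishing (h h' : C -> C) :
  (forall z, Cmod z < 1 -> is_Cderive h z (h' z)) ->
  h (RtoC 0) <> 0 ->
  (forall z, Cmod z < 1 -> 0 <= Re (1 + z * h' z / h z)%C) ->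
  forall z, Cmod z < 1 -> h z <> 0.
Proof.
intros hd h0 hpos z hz hzero.
pose proof (Cmod_ge_0 z) as hz0.
set (phi := fun t : R => t ^ 2 * (Re (h (t * z)%C) ^ 2 + Im (h (t * z)%C) ^ 2)).
assert (hin : forall t : R, 0 <= t <= 1 -> Cmod (t * z)%C < 1).
{ intros t ht; rewrite Cmod_mult, Cmod_R, Rabs_pos_eq by lra; nra. }
set (dphi := fun t : R => 2 * t * (Re (h (t * z)%C) ^ 2 + Im (h (t * z)%C) ^ 2)
  + t ^ 2 * (2 * Re (h (t * z)%C) * Re (z * h' (t * z))%C
             + 2 * Im (h (t * z)%C) * Im (z * h' (t * z))%C)).
assert (hder : forall t, 0 <= t <= 1 -> is_derive phi t (dphi t)).
{ intros t ht.
  destruct (is_derive_Cderive_curve h (fun t => (t * z)%C) t _ z (hd _ (hin t ht)))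
    as [hr hi].
  - apply (is_derive_ext (fun t => t * Re z)).
    { intros; unfold Re; simpl; ring. }
    auto_derive; [trivial|ring].
  - apply (is_derive_ext (fun t => t * Im z)).
    { intros; unfold Im; simpl; ring. }
    auto_derive; [trivial|ring].
  - unfold phi, dphi.
    set (u := fun s : R => Re (h (s * z)%C)) in *; set (v := fun s : R => Im (h (s * z)%C)) in *.
    change (is_derive (fun s => s ^ 2 * (u s ^ 2 + v s ^ 2)) t
      (2 * t * (u t ^ 2 + v t ^ 2) + t ^ 2 * (2 * u t * Re (z * h' (t * z))%C
             + 2 * v t * Im (z * h' (t * z))%C))).
    change (is_derive u t (Re (z * h' (t * z))%C)) in hr.
    change (is_derive v t (Im (z * h' (t * z))%C)) in hi.
    clearbody u v; auto_derive.
    + repeat split; first [exact (ex_intro _ _ hr) | exact (ex_intro _ _ hi)].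
    + rewrite (is_derive_unique _ t _ hr : Derive (fun x : R => u x) t = _),
        (is_derive_unique _ t _ hi : Derive (fun x : R => v x) t = _).
      ring. }
assert (hge : forall t, 0 <= t <= 1 -> 0 <= dphi t).
{ intros t ht; unfold dphi.
  specialize (hpos _ (hin t ht)).
  set (H := h (t * z)%C) in *; set (D := (z * h' (t * z))%C).
  (* Where [H = 0] the quotient carries no information, but every term of [dphi] then has a
     vanishing factor. *)
  destruct (Req_dec (Re H ^ 2 + Im H ^ 2) 0) as [e|e].
  - assert (Re H = 0) by nra; assert (Im H = 0) by nra; rewrite H0, H1; nra.
  - assert (e' : 0 < Re H ^ 2 + Im H ^ 2).
    { pose proof (pow2_ge_0 (Re H)); pose proof (pow2_ge_0 (Im H)); lra. }
    replace (Re (1 + t * z * h' (t * z) / H)%C) with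
      (1 + t * (Re D * Re H + Im D * Im H) / (Re H ^ 2 + Im H ^ 2)) in hpos.
    2:{ replace (t * z * h' (t * z))%C with (t * D)%C by (unfold D; ring).
        clearbody D H; clear -e.
        unfold Re, Im in *; simpl in *; field.
        intro e0; apply e; rewrite <- e0; ring. }
    replace (2 * t * (Re H ^ 2 + Im H ^ 2) + t ^ 2 * (2 * Re H * Re D + 2 * Im H * Im D))
      with (2 * t * (Re H ^ 2 + Im H ^ 2) *
        (1 + t * (Re D * Re H + Im D * Im H) / (Re H ^ 2 + Im H ^ 2))) by (field; exact e).
    apply Rmult_le_pos; [|assumption]; apply Rmult_le_pos; lra. }
destruct (is_Cderive_continuous h (RtoC 0) _ (hd (RtoC 0) ltac:(rewrite Cmod_0; lra))
  (Cmod (h (RtoC 0))) (proj1 (Cmod_gt_0 _) h0)) as [d [hd0 Hd]].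
(* Then [|t z| < d], so [h (t z)] is closer to [h 0] than [|h 0|] and cannot vanish, whereas
   monotonicity from [t] to 1 forces it to. *)
set (t := Rmin 1 (d / 2)).
assert (ht : 0 < t <= 1) by (split; [apply Rmin_case; lra|apply Rmin_l]).
assert (htd : t <= d / 2) by apply Rmin_r.
assert (hphi1 : phi 1 = 0).
{ unfold phi; rewrite Cmult_1_l, hzero; unfold Re, Im; simpl; ring. }
assert (hle : phi t <= phi 1).
{ destruct (MVT_gen phi t 1 dphi) as [c [hc1 hc2]];
    rewrite ?Rmin_left, ?Rmax_right in * by lra.
  - intros s hs; apply hder; lra.
  - intros s hs; apply continuity_pt_filterlim.
    apply (ex_derive_continuous (V := R_NormedModule) phi); eexists; apply hder; lra.
  - assert (0 <= dphi c) by (apply hge; lra); nra. }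
assert (htz : Cmod (t * z - RtoC 0)%C < d).
{ replace (t * z - RtoC 0)%C with (t * z)%C by ring.
  rewrite Cmod_mult, Cmod_R, Rabs_pos_eq by lra; nra. }
specialize (Hd _ htz).
assert (hsq : Re (h (t * z)%C) ^ 2 + Im (h (t * z)%C) ^ 2 <= 0).
{ unfold phi in hle at 1; assert (0 < t ^ 2) by (apply pow_lt; lra); nra. }
rewrite <- Cmod_sqr in hsq.
assert (hz' : Cmod (h (t * z)%C) = 0) by (pose proof (Cmod_ge_0 (h (t * z)%C)); nra).
rewrite (Cmod_eq_0 _ hz') in Hd.
replace (0 - h (RtoC 0))%C with (- h (RtoC 0))%C in Hd by ring.
rewrite Cmod_opp in Hd; lra.
Qed.

Lemma normalized_expansion_Cpsum (f : C -> C) (a : nat -> C) :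
  normalized_expansion f a -> Cpsum a f.
Proof.
intros [_ [_ h]] z hz.
eapply is_Cseries_ext; [|exact (h z hz)].
intros n; change (pow_n (K := C_AbsRing) z n * a n = a n * z ^ n)%C.
replace (pow_n (K := C_AbsRing) z n) with (z ^ n)%C; [ring|].
induction n as [|n IH]; [reflexivity|].
rewrite Cpow_S, IH; reflexivity.
Qed.

(** The numerators, apart from the powers of [r], are the first coefficients [q1], [q2], [q3] of
    [z f'' / f'], found by comparing coefficients in [(q1 z + q2 z^2 + q3 z^3 + ...) f' = z f'']; so
    [qk / B = ck]. *)
Lemma convex_moments (beta : R) (f : C -> C) (a : nat -> C) (r : R) :
  0 <= beta < 1 -> 0 < r < 1 ->
  normalized_expansion f a -> convex_of_order beta f ->
  positive_moments
    (r * (2%R * a 2%nat) / (1 - beta)%R / 2)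
    (r ^ 2 * (6%R * a 3%nat - 4%R * a 2%nat ^ 2) / (1 - beta)%R / 2)
    (r ^ 3 * (12%R * a 4%nat - 18%R * (a 2%nat * a 3%nat) + 8%R * a 2%nat ^ 3)
      / (1 - beta)%R / 2).
Proof.
intros hbeta hr hexp [_ hconv].
pose proof (normalized_expansion_Cpsum f a hexp) as hf.
destruct hexp as [_ [ha1 _]].
set (B := 1 - beta).
assert (hB : 0 < B <= 1) by (unfold B; lra).
destruct (Cpsum_derive a f hf) as [h [hh hfh]].
destruct (Cpsum_derive _ h hh) as [h' [hh' hhh']].
pose proof (Cpsum_Cdiff 2 _ _ hh) as dh; pose proof (Cpsum_Cdiff 2 _ _ hh') as dh'.
(* Four terms are split off [f'] but only three off [f''], which enters multiplied by [z]; both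
   tails then carry [z^4]. *)
destruct (Cpsum_split _ _ hh) as [t1 [e1 E1]].
destruct (Cpsum_split _ _ e1) as [t2 [e2 E2]].
destruct (Cpsum_split _ _ e2) as [t3 [e3 E3]].
destruct (Cpsum_split _ _ e3) as [t4 [e4 E4]].
destruct (Cpsum_split _ _ hh') as [s1 [g1 G1]].
destruct (Cpsum_split _ _ g1) as [s2 [g2 G2]].
destruct (Cpsum_split _ _ g2) as [s3 [g3 G3]].
pose proof (Cpsum_Cdiff 2 _ _ e4) as dt4; pose proof (Cpsum_Cdiff 2 _ _ g3) as ds3.
clear e1 e2 e3 e4 g1 g2 g3 hh hh' hf.
assert (i2 : INR 2 = 2) by (simpl; ring).
assert (i3 : INR 3 = 3) by (simpl; ring).
assert (i4 : INR 4 = 4) by (simpl; ring).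
rewrite ha1, INR_1 in E1.
rewrite i2 in E2; rewrite i3 in E3; rewrite i4 in E4.
rewrite INR_1, i2 in G1; rewrite i2, i3 in G2; rewrite i3, i4 in G3.
set (b1 := a 2%nat) in *; set (b2 := a 3%nat) in *; set (b3 := a 4%nat) in *.
assert (hD1 : forall z, Cmod z < 1 -> C_derive f z = h z).
{ intros z hz; apply is_C_derive_unique, hfh, hz. }
assert (hD2 : forall z, Cmod z < 1 -> C_derive (C_derive f) z = h' z).
{ intros z hz; apply is_C_derive_unique.
  apply (is_Cderive_ext_disk 1 h); [|exact hz|apply hhh', hz].
  intros w hw; symmetry; apply hD1, hw. }
assert (hpos : forall z, Cmod z < 1 -> beta < Re (1 + z * h' z / h z)%C).
{ intros z hz; rewrite <- (hD1 z hz), <- (hD2 z hz); apply hconv, hz. }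
(* Division being total, the inequality [hpos] does not presuppose this; it is needed for [/ h] to
   be differentiable. *)
assert (hne : forall z, Cmod z < 1 -> h z <> 0).
{ apply (convexity_nonvanishing h h'); [exact hhh'| |].
  - rewrite E1 by (rewrite Cmod_0; lra).
    replace (1%R * 1 + 0 * t1 0)%C with (RtoC 1) by ring.
    intro e; injection e; lra.
  - intros z hz; pose proof (hpos z hz); lra. }
clear hD1 hD2 hfh hhh' hconv.
set (q1 := (2%R * b1)%C).
set (q2 := (6%R * b2 - 4%R * b1 ^ 2)%C).
set (q3 := (12%R * b3 - 18%R * (b1 * b2) + 8%R * b1 ^ 3)%C).
assert (hBC : RtoC B <> 0) by (intro e; injection e; lra).
set (P := fun z => (1 + / B * (z * h' z * / h z))%C).
(* The remainder of [z h' - (q1 z + q2 z^2 + q3 z^3) h] with [z^4] already cancelled by hand: no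
   division by [z] occurs, so [Q] is visibly differentiable at 0. *)
set (S := fun z => (s3 z + - (1) * (2%R * b1 * q3 + 3%R * b2 * q2 + 4%R * b3 * q1
  + z * (3%R * b2 * q3 + 4%R * b3 * q2) + z * (z * (4%R * b3 * q3))
  + t4 z * (z * q1 + z * (z * q2) + z * (z * (z * q3)))))%C).
set (Q := fun z => (/ B * (S z * / h z))%C).
assert (dP : Cdiff 1 2 P).
{ unfold P; repeat first [assumption | apply Cdiff_const | apply Cdiff_id
    | apply Cdiff_plus | apply Cdiff_mult | apply Cdiff_inv]. }
assert (dQ : Cdiff 1 2 Q).
{ unfold Q, S; repeat first [assumption | apply Cdiff_const | apply Cdiff_id
    | apply Cdiff_plus | apply Cdiff_mult | apply Cdiff_inv]. }
assert (hPQ : forall z, Cmod z < 1 -> P z =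
  (1 + q1 / B * z + q2 / B * z ^ 2 + q3 / B * z ^ 3 + z ^ 4 * Q z)%C).
{ intros z hz; unfold P, Q.
  assert (hz' : (z * h' z = (q1 * z + q2 * z ^ 2 + q3 * z ^ 3) * h z + z ^ 4 * S z)%C).
  { rewrite (G1 z hz), (G2 z hz), (G3 z hz), (E1 z hz), (E2 z hz), (E3 z hz), (E4 z hz).
    unfold S, q1, q2, q3; ring. }
  rewrite hz'; field; split; [apply hne, hz|exact hBC]. }
assert (hr1 : 1 < 1 / r) by (apply Rlt_div_r; lra).
assert (hrin : forall z, Cmod z < 1 / r -> Cmod (r * z)%C < 1).
{ intros z hz; rewrite Cmod_mult, Cmod_R, Rabs_pos_eq by lra.
  apply Rlt_div_r in hz; lra. }
apply (Caratheodory_moments (1 / r) (fun z => P (r * z)%C)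
  (fun z => (r ^ 4 * Q (r * z))%C)); [exact hr1| | | |].
- apply Cdiff_dilate; [lra|exact dP].
- apply Cdiff_mult; [apply Cdiff_const|].
  apply Cdiff_dilate; [lra|exact dQ].
- intros z hz; rewrite (hPQ _ (hrin z hz)); field; exact hBC.
- intros z hz.
  assert (hz1 : Cmod (r * z)%C < 1) by (apply hrin; rewrite hz; exact hr1).
  specialize (hpos _ hz1).
  unfold P; set (X := (r * z * h' (r * z) * / h (r * z))%C).
  change (beta < Re (1 + X)%C) in hpos.
  replace (/ RtoC B)%C with (RtoC (/ B)) by (apply RtoC_inv; lra).
  replace (Re (1 + RtoC (/ B) * X)%C) with (/ B * (Re (1 + X)%C - beta)).
  + apply Rmult_le_pos; [apply Rlt_le, Rinv_0_lt_compat|]; lra.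
  + assert (hB0 : B <> 0) by lra.
    replace beta with (1 - B) by (unfold B; ring).
    clearbody X; unfold Re; simpl; field; exact hB0.
Qed.

Theorem theorem2p3 (beta : R) (f : C -> C) (a : nat -> C)
  (hbeta : 0 <= beta < 1)
  (hexp : normalized_expansion f a)
  (hf : bi_convex_of_order beta f) :
  Cmod (a 2%nat * a 4%nat - a 3%nat ^ 2)%C
  <= (1 - beta) ^ 2 / 24 *
     ((5 * beta ^ 2 + 8 * beta - 32) / (3 * beta ^ 2 - 3 * beta - 4)).
Proof.
destruct hf as [_ [hconv _]].
(* The coefficient bound loses a factor [r ^ -4]; there is enough room to fix [r]. *)
set (r := 19 / 20).
assert (hr : 0 < r < 1) by (unfold r; lra).
pose proof (convex_moments beta f a r hbeta hr hexp hconv) as hm.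
set (B := 1 - beta) in *.
assert (hB : 0 < B <= 1) by (unfold B; lra).
pose proof (moment_Hankel_bound _ _ _ B hm ltac:(lra)) as hH.
assert (hrC : RtoC r <> 0) by (intro e; injection e; lra).
assert (hBC : RtoC B <> 0) by (intro e; injection e; lra).
(* Every monomial of [E] has total index 4, as in [m1 m3] or [m1^2 m2], so the dilation contributes
   exactly [r^4]. *)
match type of hH with Cmod ?E <= _ =>
  assert (heq : (RtoC (144 * r ^ 4) * (a 2%nat * a 4%nat - a 3%nat ^ 2)
    = RtoC (B ^ 2) * E)%C) end.
{ rewrite !RtoC_mult, !RtoC_pow; field; exact hBC. }
assert (h1 : 144 * r ^ 4 * Cmod (a 2%nat * a 4%nat - a 3%nat ^ 2)%C <= B ^ 2 * 22).
{ apply (f_equal Cmod) in heq.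
  rewrite !Cmod_mult, !Cmod_R, !Rabs_pos_eq in heq.
  2:{ apply pow2_ge_0. }
  2:{ apply Rmult_le_pos; [lra|apply pow_le; lra]. }
  rewrite heq; apply Rmult_le_compat_l; [apply pow2_ge_0|exact hH]. }
(* This requires [r^4 >= 44 / 57], about [0.772]; [(19 / 20)^4] is about [0.814]. *)
assert (h2 : Cmod (a 2%nat * a 4%nat - a 3%nat ^ 2)%C <= B ^ 2 / 24 * (19 / 4)).
{ unfold r in h1; pose proof (pow2_ge_0 B); lra. }
eapply Rle_trans; [exact h2|].
apply Rmult_le_compat_l; [pose proof (pow2_ge_0 B); lra|].
assert (hD : 0 < 4 + 3 * beta - 3 * beta ^ 2) by nra.
replace ((5 * beta ^ 2 + 8 * beta - 32) / (3 * beta ^ 2 - 3 * beta - 4))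
  with ((32 - 8 * beta - 5 * beta ^ 2) / (4 + 3 * beta - 3 * beta ^ 2))
  by (field; split; intro; lra).
(* After clearing the denominator, the difference of the two sides factors as
   [(1 - beta) (13 - 37 beta / 4)]. *)
apply (proj1 (Rle_div_r (19 / 4) _ _ hD)); nra.
Qed.
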